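(* The scheme $\sim((\alpha\vee\beta)\vee\gamma)\rightarrow_{d}\sim(\alpha\vee(\beta\vee\gamma))$ is not provable in the axiom system $\mathrm{C}$; that is, there are formulas $\alpha,\beta,\gamma$ such that $\sim((\alpha\vee\beta)\vee\gamma)\rightarrow_{d}\sim(\alpha\vee(\beta\vee\gamma))$ is not a theorem of $\mathrm{C}$.
   Context: Formulas are built from a countably infinite set of propositional variables using the unary connective $\sim$ (negation) and the binary connectives $\vee$ (disjunction), $\rightarrow_{d}$ (discussive implication), $\wedge_{d}$ (discussive conjunction), all treated as primitive. $\sim$ binds more tightly than the binary connectives. The axiom system $\mathrm{C}$ has as its sole rule modus ponens for $\rightarrow_{d}$ (from $\alpha$ and $\alpha\rightarrow_{d}\beta$ infer $\beta$), and as axioms all instances (for arbitrary formulas $\alpha,\beta,\gamma$) of the following schemes: C1: $\alpha\rightarrow_{d}(\beta\rightarrow_{d}\alpha)$. C2: $(\alpha\rightarrow_{d}(\beta\rightarrow_{d}\gamma))\rightarrow_{d}((\alpha\rightarrow_{d}\beta)\rightarrow_{d}(\alpha\rightarrow_{d}\gamma))$. C3: $(\alpha\wedge_{d}\beta)\rightarrow_{d}\alpha$. C4: $(\alpha\wedge_{d}\beta)\rightarrow_{d}\beta$. C5: $\alpha\rightarrow_{d}(\beta\rightarrow_{d}(\alpha\wedge_{d}\beta))$. C6: $\alpha\rightarrow_{d}(\alpha\vee\beta)$. C7: $\beta\rightarrow_{d}(\alpha\vee\beta)$. C8: $(\alpha\rightarrow_{d}\gamma)\rightarrow_{d}((\beta\rightarrow_{d}\gamma)\rightarrow_{d}((\alpha\vee\beta)\rightarrow_{d}\gamma))$.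 C9: $\alpha\vee(\alpha\rightarrow_{d}\beta)$. C10: $\sim(\sim\alpha\wedge_{d}(\sim\sim\alpha\wedge_{d}\sim(\alpha\vee\sim\alpha)))$. C11: $\sim(\sim\alpha\wedge_{d}(\sim\beta\wedge_{d}\sim(\alpha\vee\beta)))\rightarrow_{d}\sim(\sim\alpha\wedge_{d}(\sim\beta\wedge_{d}(\sim\gamma\wedge_{d}\sim(\alpha\vee(\beta\vee\gamma)))))$. C12: $\sim(\sim\alpha\wedge_{d}(\sim\beta\wedge_{d}(\sim\gamma\wedge_{d}\sim(\alpha\vee(\beta\vee\gamma)))))\rightarrow_{d}\sim(\sim\alpha\wedge_{d}(\sim\gamma\wedge_{d}(\sim\beta\wedge_{d}\sim(\alpha\vee(\gamma\vee\beta)))))$. C13: $\sim(\sim\alpha\wedge_{d}(\sim\beta\wedge_{d}(\sim\gamma\wedge_{d}\sim(\alpha\vee(\beta\vee\gamma)))))\rightarrow_{d}((\alpha\vee(\beta\vee\sim\gamma))\rightarrow_{d}(\alpha\vee\beta))$. C14: $\sim(\sim\alpha\wedge_{d}\sim\beta)\rightarrow_{d}(\alpha\vee\beta)$. C15: $(\alpha\vee(\beta\vee\sim\beta))\rightarrow_{d}\sim(\sim\alpha\wedge_{d}\sim(\beta\vee\sim\beta))$. A theorem of $\mathrm{C}$ is a formula derivable from these axioms by finitely many applications of modus ponens. A scheme is said to be unprovable in $\mathrm{C}$ if at least one of its instances is not a theorem of $\mathrm{C}$. *)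

(* Defs.v *)
Inductive formula : Type :=
| Var : nat -> formula
| Neg : formula -> formula
| Disj : formula -> formula -> formula
| DImp : formula -> formula -> formula
| DConj : formula -> formula -> formula.

Declare Scope formula_scope.
Delimit Scope formula_scope with F.
Bind Scope formula_scope with formula.

(* The symbols and levels agree with those of the boolean connectives in
   ssrbool, but here each one is a primitive connective of the object
   language; && and ==> are the discussive conjunction and implication. *)
Notation "~~ a" := (Neg a) (at level 35, right associativity) : formula_scope.
Notation "a && b" := (DConj a b) (at level 40, left associativity) : formula_scope.
Notation "a || b" := (Disj a b) (at level 50, left associativity) : formula_scope.
Notation "a ==> b" := (DImp a b) (at level 55, right associativity) : formula_scope.

Inductive axiom_C : formula -> Prop :=
| C1 (a b : formula) : axiom_C (a ==> (b ==> a))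
| C2 (a b c : formula) :
    axiom_C ((a ==> (b ==> c)) ==> ((a ==> b) ==> (a ==> c)))
| C3 (a b : formula) : axiom_C ((a && b) ==> a)
| C4 (a b : formula) : axiom_C ((a && b) ==> b)
| C5 (a b : formula) : axiom_C (a ==> (b ==> (a && b)))
| C6 (a b : formula) : axiom_C (a ==> (a || b))
| C7 (a b : formula) : axiom_C (b ==> (a || b))
| C8 (a b c : formula) :
    axiom_C ((a ==> c) ==> ((b ==> c) ==> ((a || b) ==> c)))
| C9 (a b : formula) : axiom_C (a || (a ==> b))
| C10 (a : formula) : axiom_C (~~ (~~ a && (~~ ~~ a && ~~ (a || ~~ a))))
| C11 (a b c : formula) :
    axiom_C (~~ (~~ a && (~~ b && ~~ (a || b)))
             ==> ~~ (~~ a && (~~ b && (~~ c && ~~ (a || (b || c))))))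
| C12 (a b c : formula) :
    axiom_C (~~ (~~ a && (~~ b && (~~ c && ~~ (a || (b || c)))))
             ==> ~~ (~~ a && (~~ c && (~~ b && ~~ (a || (c || b))))))
| C13 (a b c : formula) :
    axiom_C (~~ (~~ a && (~~ b && (~~ c && ~~ (a || (b || c)))))
             ==> ((a || (b || ~~ c)) ==> (a || b)))
| C14 (a b : formula) : axiom_C (~~ (~~ a && ~~ b) ==> (a || b))
| C15 (a b : formula) :
    axiom_C ((a || (b || ~~ b)) ==> ~~ (~~ a && ~~ (b || ~~ b))).

Inductive theorem_C : formula -> Prop :=
| Ax (a : formula) : axiom_C a -> theorem_C a
| MP (a b : formula) : theorem_C a -> theorem_C (a ==> b) -> theorem_C b.

(* Main.v *)
(** The axioms C1-C9 hold in any two-valued interpretation that is classical on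
    disjunction, discussive implication and discussive conjunction, whatever
    the values of the negations.  The values of the negations can thus be
    chosen by the shape of the negated formula, subject to C10-C15.  All
    variables are made true, and the negation of a disjunction is false exactly
    when its left disjunct is a variable; this separates the two bracketings.
    The negations of the conjunctions occurring in C10-C15 are then fixed so
    that these axioms hold, which is possible because excluded middle holds
    and a disjunction with a false negation has a true left disjunct. *)

Require Import Defs.
From Stdlib Require Import Bool.

Definition is_var (x : formula) : bool :=
  match x with Var _ => true | _ => false end.

(** [falsum x] is the value of [~~ x].  It is no function of the value of [x]. *)
Fixpoint verum (x : formula) : bool :=
  match x with
  | Var _ => true
  | Neg a => falsum a
  | Disj a b => verum a || verum b
  | DImp a b => implb (verum a) (verum b)
  | DConj a b => verum a && verum b
  end
with falsum (x : formula) : bool :=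
  match x with
  | Neg a => negb (falsum a)
  | Disj a _ => negb (is_var a)
  | DConj (Neg a) (Neg b) => verum a || verum b
  | DConj (Neg a) (DConj (Neg b) (Neg d)) =>
      verum a || negb (falsum b) || negb (falsum d)
  (* The first disjunct is the weakest value that is symmetric in [b] and [c],
     as C12 asks, and that satisfies C13. *)
  | DConj (Neg a) (DConj (Neg b) (DConj (Neg c) (Neg d))) =>
      implb (falsum c) (verum a || verum b)
      && implb (falsum b) (verum a || verum c)
      || negb (falsum d)
  | _ => true
  end.

(** If a conjunction of one of the listed shapes is false, so is some conjunct [~~ y]; then
    [falsum y = false], and this with the truth of [y] given by induction makes the negation
    true. *)
Lemma excluded_middle (x : formula) : verum x || falsum x = true.
Proof.
  (* The conjunction shapes need the hypothesis for subformulas several levels down, hence [fix]. *)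
  revert x; fix IH 1; intros [n | a | a b | a b | a b].
  - reflexivity.
  - simpl; now destruct (falsum a).
  - now destruct a; simpl; rewrite ?orb_true_r.
  - apply orb_true_r.
  - destruct a as [| a | | |]; try apply orb_true_r.
    pose proof (IH a) as Ha.
    destruct b as [| b | | | b b']; try apply orb_true_r.
    + pose proof (IH b) as Hb; simpl.
      destruct (verum a), (falsum a), (verum b), (falsum b); easy.
    + destruct b as [| b | | |]; try apply orb_true_r.
      pose proof (IH b) as Hb.
      destruct b' as [| d | | | c d]; try apply orb_true_r.
      * simpl.
        destruct (verum a), (falsum a), (falsum b), (falsum d); easy.
      * destruct c as [| c | | |]; try apply orb_true_r.
        destruct d as [| d | | |]; try apply orb_true_r.
        pose proof (IH c) as Hc; simpl.
        destruct (verum a), (falsum a), (verum b), (falsum b),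
          (verum c), (falsum c), (falsum d); easy.
Qed.

Lemma verum_var (a : formula) : implb (is_var a) (verum a) = true.
Proof. now destruct a. Qed.

Lemma verum_axiom (x : formula) : axiom_C x -> verum x = true.
Proof.
  intros [a b | a b c | a b | a b | a b | a b | a b | a b c | a b
         | a | a b c | a b c | a b c | a b | a b];
    cbn -[falsum].
  1-9: repeat match goal with |- context [verum ?y] => destruct (verum y) end;
       reflexivity.
  - pose proof (excluded_middle a); cbn [falsum].
    destruct (verum a), (falsum a); easy.
  (* C11: if the premise holds because [falsum b] is false, excluded middle makes [b] true. *)
  - pose proof (verum_var a); pose proof (excluded_middle b).
    cbn [falsum].
    destruct (verum a), (verum b), (falsum b), (verum c), (falsum c),
      (is_var a); easy.
  - pose proof (verum_var a).
    cbn [falsum].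
    destruct (verum a), (verum b), (falsum b), (verum c), (falsum c),
      (is_var a); easy.
  - pose proof (verum_var a).
    cbn [falsum].
    destruct (verum a), (verum b), (falsum b), (verum c), (falsum c),
      (is_var a); easy.
  - cbn [falsum]; destruct (verum a), (verum b); easy.
  - pose proof (excluded_middle b); cbn [falsum verum].
    destruct (verum a), (verum b), (falsum b); easy.
Qed.

Lemma verum_theorem (x : formula) : theorem_C x -> verum x = true.
Proof.
  induction 1 as [x Hx | x y _ IHx _ IHxy].
  - now apply verum_axiom.
  - simpl in IHxy; now rewrite IHx in IHxy.
Qed.

Theorem proposition2p7 :
  exists a b c : formula,
    ~ theorem_C (~~ ((a || b) || c) ==> ~~ (a || (b || c))).
Proof.
  exists (Var 0), (Var 0), (Var 0); intros H.
  now apply verum_theorem in H.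
Qed.
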